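(* Let $P_0,P_1\in CC_+\setminus\{\overline{\mathbb R^n_+}\}$ and let $P_t^\oplus$, $0<t<1$, be their copolar combinations. Then $$\operatorname{Covol}(P_t^\oplus)\le (1-t)\,\operatorname{Covol}(P_0)+t\,\operatorname{Covol}(P_1),\qquad 0<t<1.$$ Moreover, equality occurs in this inequality for some $t\in(0,1)$ if and only if $P_0=P_1$.
   Context: $\mathbb R^n_+=\{a\in\mathbb R^n: a_j>0,\ 1\le j\le n\}$, and $\overline{\mathbb R^n_+}$ is its closure. $C_+$ is the collection of closed convex subsets $\Gamma\subset\overline{\mathbb R^n_+}$ that are complete, i.e. $\Gamma+\mathbb R^n_+\subset\Gamma$. $CC_+$ is the subclass of those $\Gamma\in C_+$ that are cobounded, i.e. $\mathbb R^n_+\setminus\Gamma$ is bounded. For $P\in CC_+$, $\operatorname{Covol}(P)=\operatorname{Vol}(\mathbb R^n_+\setminus P)$, where $\operatorname{Vol}$ is Lebesgue measure on $\mathbb R^n$. For a set $A\subset\mathbb R^n$, its copolar is $A^\circ=\{x\in\mathbb R^n:\ \langle x,y\rangle\le -1\ \text{ for all } y\in A\}$. The copolar combinations of $P_0,P_1$ are $$P_t^\oplus=\left((1-t)P_0^\circ+t\,P_1^\circ\right)^\circ,\qquad 0<t<1,$$ where the sum inside the parentheses is the Minkowski sum. *)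

(* Defs.v *)
From mathcomp Require Import all_boot all_order all_algebra.
From mathcomp Require Import all_classical all_reals all_analysis.
Import Order.TTheory GRing.Theory Num.Theory.
Import numFieldNormedType.Exports.

Set Implicit Arguments.
Unset Strict Implicit.
Unset Printing Implicit Defensive.

Local Open Scope classical_set_scope.
Local Open Scope ring_scope.

(* Lebesgue measure on R^n as the n-fold product of the one-dimensional one,
   first on tuples, the library's measurable model of R^n, starting from the
   unit mass on R^0; the two types carry the product sigma-algebra, i.e. the
   Borel sets. *)
Fixpoint lebesgue_tuple (R : realType) (n : nat) :
    set (n.-tuple (measurableTypeR R)) -> \bar R :=
  match n with
  | 0 => dirac [tuple]
  | m.+1 =>
      pushforward
        (product_measure1 (@lebesgue_measure R) (@lebesgue_tuple R m))
        (fun p : measurableTypeR R * m.-tuple (measurableTypeR R) =>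
           [tuple of p.1 :: p.2])
  end.

Definition Vol (R : realType) (n : nat) (A : set 'rV[R]_n) : \bar R :=
  lebesgue_tuple [set t : n.-tuple (measurableTypeR R) | A (\row_i tnth t i)].

Definition inner (R : realType) (n : nat) (x y : 'rV[R]_n) : R :=
  \sum_(i < n) x ord0 i * y ord0 i.

Definition minkowski_sum (R : realType) (n : nat) (A B : set 'rV[R]_n) :
    set 'rV[R]_n :=
  [set x + y | x in A & y in B].

Definition dilate (R : realType) (n : nat) (c : R) (A : set 'rV[R]_n) :
    set 'rV[R]_n :=
  [set c *: x | x in A].

Definition orthant (R : realType) (n : nat) : set 'rV[R]_n :=
  [set a | forall j, 0 < a ord0 j].

Definition complete_set (R : realType) (n : nat) (G : set 'rV[R]_n) : Prop :=
  minkowski_sum G (@orthant R n) `<=` G.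

Definition cobounded (R : realType) (n : nat) (G : set 'rV[R]_n) : Prop :=
  bounded_set (@orthant R n `\` G).

Definition C_plus (R : realType) (n : nat) : set (set 'rV[R]_n) :=
  [set G | [/\ G `<=` closure (@orthant R n), closed G, convex_set G
             & complete_set G]].

Definition CC_plus (R : realType) (n : nat) : set (set 'rV[R]_n) :=
  [set G | @C_plus R n G /\ cobounded G].

Definition Covol (R : realType) (n : nat) (P : set 'rV[R]_n) : \bar R :=
  Vol (@orthant R n `\` P).

Definition copolar (R : realType) (n : nat) (A : set 'rV[R]_n) :
    set 'rV[R]_n :=
  [set x | forall y, A y -> inner x y <= -1].

Definition copolar_comb (R : realType) (n : nat) (P0 P1 : set 'rV[R]_n)
    (t : R) : set 'rV[R]_n :=
  copolar (minkowski_sum (dilate (1 - t) (copolar P0)) (dilate t (copolar P1))).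

(* Main.v *)
(* Write [O] for the open orthant and, for [x] in [O], let
   [g_P(x) = inf { - <u, x> : u in copolar P }]. Separating a point from its
   nearest point in [P] gives [O \ P = {g_P < 1}], and by definition of the
   Minkowski sum [O \ P_t = {(1 - t) g_0 + t g_1 < 1}]. Since [g] is
   nonnegative and homogeneous of degree one, integrating the superlevel sets of
   the tent [(1 - g)_+] and scaling shows that the integral of [(1 - g)_+] over
   [O] is [c Vol {g < 1}], where [0 < c < +oo] depends only on [n]. The
   inequality then follows from the convexity of [s |-> (1 - s)_+]. If [g_0]
   and [g_1] differ at a point, homogeneity moves it to one where
   [g_0 < 1 < g_1] (or the reverse); there the convexity is strict across the
   kink of the tent, uniformly on a small box, so equality forces
   [g_0 = g_1]. *)

From HB Require Import structures.
Require Import Defs.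
From mathcomp Require Import all_boot all_order all_algebra.
From mathcomp Require Import all_classical all_reals all_analysis.
From mathcomp Require Import measurable_realfun.
From mathcomp Require Import ring lra.
Import Order.TTheory GRing.Theory Num.Theory.
Import numFieldNormedType.Exports.

Set Implicit Arguments.
Unset Strict Implicit.
Unset Printing Implicit Defensive.

Local Open Scope classical_set_scope.
Local Open Scope ring_scope.

(** * Sigma-finiteness of image and product measures *)

Section sigma_finite.
Context d1 d2 (T1 : measurableType d1) (T2 : measurableType d2) (R : realType).

(** An exhausting sequence is pulled back along the left inverse [g]; since [g] undoes [f], each
    pulled-back set has image measure [mu (F k)]. *)
Lemma sigma_finite_pushforward (mu : set T1 -> \bar R) (f : T1 -> T2)
    (g : T2 -> T1) :
  measurable_fun setT g -> cancel f g ->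
  sigma_finite setT mu -> sigma_finite setT (pushforward mu f).
Proof.
move=> mg fK [F TF Foo]; exists (fun k => g @^-1` F k).
  by rewrite -preimage_bigcup -TF.
move=> k; have [mF oo] := Foo k; split.
  by rewrite -[_ @^-1` _]setTI; exact: mg.
rewrite /pushforward (_ : f @^-1` _ = F k)//.
by apply/seteqP; split=> x /=; rewrite fK.
Qed.

(* The library does declare this instance, but type inference never reaches it:
   an earlier one, for products of subprobabilities, has the same key. *)
Lemma sigma_finite_product (m1 : {sigma_finite_measure set T1 -> \bar R})
    (m2 : {sigma_finite_measure set T2 -> \bar R}) :
  sigma_finite setT (m1 \x m2)%E.
Proof.
exact: isSigmaFinite.sigma_finiteT (
  lebesgue_integral_fubini.measure_function_Measure_isSigmaFinite__to__measure_function_isSigmaFinite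
    m1 m2).
Qed.

End sigma_finite.

(** * Lebesgue measure on tuples: slicing, boxes and scaling *)

Section lebesgue_tuple.
Variable R : realType.
Local Notation T := (measurableTypeR R).
Local Notation leb := (@lebesgue_measure R).

Definition tuple_cons n (p : T * n.-tuple T) : n.+1.-tuple T :=
  [tuple of p.1 :: p.2].

Lemma measurable_tuple_cons n : measurable_fun setT (@tuple_cons n).
Proof. exact: measurable_cons. Qed.

(** The recursion defines a bare set function. The induction has to carry sigma-finiteness along,
    because the next product requires it of its second factor; the measure instances below are read
    off from this. *)
Lemma lebesgue_tuple_measure n :
  exists nu : {sigma_finite_measure set (n.-tuple T) -> \bar R},
    lebesgue_tuple (R := R) (n := n) = nu.
Proof.
elim: n => [|n [nu nuE]].
  by exists (dirac ([tuple] : 0.-tuple T)).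
pose mf : {measure set (n.+1.-tuple T) -> \bar R} :=
  pushforward (leb \x nu)%E (@tuple_cons n).
pose m := mf (@measurable_tuple_cons n).
have sf : sigma_finite setT m.
  apply: (@sigma_finite_pushforward _ _ _ _ _ _ _
    (fun t : n.+1.-tuple T => (thead t, [tuple of behead t]))).
  - apply/measurable_fun_pairP; split.
      exact: measurable_tnth.
    exact: measurable_behead.
  - by move=> [x t] /=; congr pair; apply: val_inj.
  - exact: sigma_finite_product.
pose S := Measure_isSigmaFinite.Build _ _ _ m sf.
pose M : {sigma_finite_measure set (n.+1.-tuple T) -> \bar R} :=
  HB.pack (Measure.sort m) (Measure.class m) S.
by exists M; rewrite /= nuE.
Qed.

Let lebesgue_tuple0 n : @lebesgue_tuple R n set0 = 0%E.
Proof. by have [nu ->] := lebesgue_tuple_measure n; rewrite measure0. Qed.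

Let lebesgue_tuple_ge0 n A : (0 <= @lebesgue_tuple R n A)%E.
Proof. by have [nu ->] := lebesgue_tuple_measure n; rewrite measure_ge0. Qed.

Let lebesgue_tuple_sigma_additive n : semi_sigma_additive (@lebesgue_tuple R n).
Proof.
by have [nu ->] := lebesgue_tuple_measure n; exact: measure_semi_sigma_additive.
Qed.

HB.instance Definition _ (n : nat) :=
  isMeasure.Build _ _ _ (@lebesgue_tuple R n) (@lebesgue_tuple0 n)
    (@lebesgue_tuple_ge0 n) (@lebesgue_tuple_sigma_additive n).

Let lebesgue_tuple_sigma_finite n : sigma_finite setT (@lebesgue_tuple R n).
Proof.
by have [nu ->] := lebesgue_tuple_measure n; exact: sigma_finiteT.
Qed.

HB.instance Definition _ (n : nat) :=
  Measure_isSigmaFinite.Build _ _ _ (@lebesgue_tuple R n)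
    (@lebesgue_tuple_sigma_finite n).

(** The product measure is by definition the integral of the measures of the slices, so this holds
    for arbitrary sets. *)
Lemma lebesgue_tupleS n (A : set (n.+1.-tuple T)) :
  lebesgue_tuple A =
  (\int[leb]_x lebesgue_tuple [set t | A (tuple_cons (x, t))])%E.
Proof.
by apply: eq_integral => x _ /=; congr lebesgue_tuple; apply/seteqP; split=> t;
  rewrite /xsection/= inE.
Qed.

Lemma measurable_lebesgue_tuple_cons n (A : set (n.+1.-tuple T)) :
  measurable A ->
  measurable_fun (setT : set T) (fun x =>
    @lebesgue_tuple R n [set t | A (tuple_cons (x, t))]).
Proof.
move=> mA; have mA' : measurable (@tuple_cons n @^-1` A).
  by rewrite -[_ @^-1` _]setTI; exact: measurable_tuple_cons.
have := measurable_fun_xsection (@lebesgue_tuple R n) mA'.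
apply: eq_measurable_fun => x _ /=; congr lebesgue_tuple.
by apply/seteqP; split=> t; rewrite /xsection/= inE.
Qed.

Lemma measurable_box n (a b : 'I_n -> R) :
  measurable [set t : n.-tuple T | forall i, a i < tnth t i < b i].
Proof.
rewrite (_ : [set t | _] =
    \bigcap_(i : 'I_n) (fun t => tnth t i) @^-1` `]a i, b i[%classic);
  last first.
  apply/seteqP; split=> t /= abt i; first by move=> _ /=; rewrite in_itv/=.
  by have /= := abt i I; rewrite in_itv.
apply: fin_bigcap_measurable => [|i _]; first exact: finite_finset.
by rewrite -[_ @^-1` _]setTI; exact: measurable_tnth.
Qed.

Lemma lebesgue_tuple_box n (a b : 'I_n -> R) : (forall i, a i <= b i) ->
  lebesgue_tuple [set t : n.-tuple T | forall i, a i < tnth t i < b i] =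
  (\prod_i (b i - a i))%:E.
Proof.
elim: n => [|n IHn] in a b *.
  by move=> _; rewrite big_ord0/= diracE mem_set// => -[].
move=> ab; rewrite lebesgue_tupleS.
pose p := \prod_(i < n) (b (lift ord0 i) - a (lift ord0 i)).
transitivity (\int[leb]_x (p%:E * (\1_`]a ord0, b ord0[ x)%:E))%E.
  apply: eq_integral => x _; rewrite indicE.
  have [|] := boolP (x \in `]a ord0, b ord0[%classic);
    rewrite ?inE ?notin_setE /= in_itv /=.
    move=> abx; rewrite mule1 -IHn//; congr lebesgue_tuple.
    apply/seteqP; split=> t /= abt i.
      by have := abt (lift ord0 i); rewrite tnthS.
    by have [j ->|->//] := unliftP ord0 i; rewrite tnthS; exact: abt.
  move=> abx; rewrite mule0 (_ : [set t | _] = set0) ?measure0//.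
  by rewrite -subset0 => t /= /(_ ord0).
rewrite ge0_integralZl//=; last 2 first.
  - exact/measurable_EFinP.
  - by rewrite lee_fin prodr_ge0// => i _; rewrite subr_ge0.
rewrite integral_indic//= setIT lebesgue_measure_itv/= lte_fin.
rewrite big_ord_recl -/p mulrC; have := ab ord0.
(* For a degenerate side, both the measure of the empty interval and the factor vanish. *)
by rewrite le_eqVlt => /predU1P[->|->//]; rewrite ltxx mule0 subrr mulr0.
Qed.

(** By uniqueness of Lebesgue measure: the right-hand side is a measure that gives half-open
    intervals their length. *)
Lemma lebesgue_measure_scale (s : R) (A : set T) : 0 < s -> measurable A ->
  leb A = (s%:E * leb ( *%R s @^-1` A))%E.
Proof.
move=> s0 mA; pose c := NngNum (ltW s0).
pose mf : {measure set T -> \bar R} := pushforward leb (( *%R s) : T -> T).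
have ms : measurable_fun (setT : set T) (( *%R s) : T -> T).
  exact: mulrl_measurable.
rewrite (@lebesgue_measure_unique _ (mscale c (mf ms)))//.
move=> _ [[a b]] _ <-.
change (leb `]a, b] = (s%:E * leb ( *%R s @^-1` `]a, b]))%E).
rewrite (_ : *%R s @^-1` _ = `](a / s), (b / s)]%classic); last first.
  apply/seteqP; split=> x /=; rewrite !in_itv/=.
    by rewrite ltr_pdivrMr// ler_pdivlMr// mulrC.
  by rewrite ltr_pdivrMr// ler_pdivlMr// mulrC.
rewrite !lebesgue_measure_itv/= !lte_fin ltr_pM2r ?invr_gt0//.
case: ifP => // _.
  by rewrite -!EFinB -EFinM -mulrBl mulrCA divff ?mulr1// gt_eqF.
by rewrite mule0.
Qed.

Lemma ge0_integral_scale (s : R) (f : T -> \bar R) : 0 < s ->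
  measurable_fun setT f -> (forall x, 0 <= f x)%E ->
  (\int[leb]_x f (s * x)%R = (s^-1)%:E * \int[leb]_x f x)%E.
Proof.
move=> s0 mf f0.
have ms : measurable_fun (setT : set T) (( *%R s) : T -> T).
  exact: mulrl_measurable.
have := ge0_integral_pushforward ms leb measurableT mf (fun x _ => f0 x).
rewrite preimage_setT => <-.
have si0 : 0 <= s^-1 by rewrite invr_ge0 ltW.
transitivity (\int[mscale (NngNum si0) leb]_x f x)%E; last first.
  by rewrite ge0_integral_mscale.
apply: eq_measure_integral => A mA _.
change (leb ( *%R s @^-1` A) = ((s^-1)%:E * leb A)%E).
rewrite [in RHS](lebesgue_measure_scale s0 mA).
by rewrite muleA -EFinM mulVf ?mul1e// gt_eqF.
Qed.

(** Induction by slicing: the tail contributes [s ^- n] and the change of variable in the first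
    coordinate one more factor [s^-1]. *)
Lemma lebesgue_tuple_scale n (s : R) (A : set (n.-tuple T)) : 0 < s ->
  measurable A ->
  lebesgue_tuple [set t | A (map_tuple ( *%R s) t)] =
    ((s ^- n)%:E * lebesgue_tuple A)%E.
Proof.
move=> s0; elim: n => [|n IHn] in A *.
  move=> mA; rewrite expr0 invr1 mul1e; congr lebesgue_tuple.
  by apply/seteqP; split=> t /=; rewrite (tuple0 t) (tuple0 (map_tuple _ _)).
move=> mA; rewrite !lebesgue_tupleS.
pose g (x : T) : \bar R := lebesgue_tuple [set t | A (tuple_cons (x, t))].
have mg : measurable_fun setT g by exact: measurable_lebesgue_tuple_cons.
have mgs : measurable_fun (setT : set T) (fun x : T => g (s * x)).
  by apply: (measurableT_comp mg); exact: mulrl_measurable.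
transitivity (\int[leb]_x ((s ^- n)%:E * g (s * x)%R))%E.
  apply: eq_integral => x _; rewrite -IHn.
    congr lebesgue_tuple; apply/funext => t /=; congr A.
    by apply: val_inj.
  have mc : measurable_fun (setT : set (n.-tuple T))
      (fun t => tuple_cons (s * x : T, t)).
    by apply: measurable_cons; [exact: measurable_cst|exact: measurable_id].
  by have := mc measurableT _ mA; rewrite setTI.
transitivity ((s ^- n)%:E * \int[leb]_x g (s * x)%R)%E.
  apply: ge0_integralZl => //.
  by rewrite lee_fin invr_ge0 exprn_ge0// ltW.
rewrite ge0_integral_scale// muleA -EFinM; congr (_%:E * _)%E.
by rewrite exprSr invfM.
Qed.

End lebesgue_tuple.

(** * Open sets of row vectors are Borel on tuples *)

Section open_measurable.
Variables (R : realType) (n : nat).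
Local Notation T := (measurableTypeR R).

Definition rV_of_tuple (t : n.-tuple T) : 'rV[R]_n := \row_i tnth t i.

(** An open set is the union of the rational boxes inside it, and there are countably many of
    them. *)
Lemma measurable_open_rV (U : set 'rV[R]_n) : open U ->
  measurable (rV_of_tuple @^-1` U).
Proof.
move=> oU.
pose box (pq : n.-tuple rat * n.-tuple rat) := [set t : n.-tuple T |
  forall i, ratr (tnth pq.1 i) < tnth t i < ratr (tnth pq.2 i)].
have -> : rV_of_tuple @^-1` U =
    \bigcup_(pq in [set pq | box pq `<=` rV_of_tuple @^-1` U]) box pq.
  apply/seteqP; split=> [t Ut|t [pq /= sub] /sub//].
  have [e e0 eU] : exists2 e : R, 0 < e & ball (rV_of_tuple t) e `<=` U.
    by move: oU; rewrite openE => /(_ _ Ut) /nbhs_ballP[e /= e0 eU]; exists e.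
  have /fin_all_exists[p Hp] : forall i : 'I_n, exists p : rat,
      tnth t i - e < ratr p < tnth t i.
    move=> i; have [|p] := @rat_in_itvoo R (tnth t i - e) (tnth t i).
      by rewrite ltrBlDr ltrDl.
    by rewrite in_itv/= => ?; exists p.
  have /fin_all_exists[q Hq] : forall i : 'I_n, exists q : rat,
      tnth t i < ratr q < tnth t i + e.
    move=> i; have [|q] := @rat_in_itvoo R (tnth t i) (tnth t i + e).
      by rewrite ltrDl.
    by rewrite in_itv/= => ?; exists q.
  exists ([tuple p i | i < n], [tuple q i | i < n]) => /=.
    move=> u /= pq; apply: eU; split=> // i j; rewrite /ball/= !mxE.
    have := pq j; rewrite !tnth_mktuple; have := Hp j; have := Hq j.
    by move=> /andP[? ?] /andP[? ?] /andP[? ?]; rewrite ltr_distlC; lra.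
  move=> i; rewrite /= !tnth_mktuple.
  by have /andP[_ ->] := Hp i; have /andP[-> _] := Hq i.
rewrite bigcup_mkcond; apply: countable_bigcupT_measurable => [|pq].
  exact: countableP.
by case: ifPn => _; [exact: measurable_box|exact: measurable0].
Qed.

End open_measurable.

(** * The layer-cake formula *)

Section layer_cake.
Context d (T : measurableType d) (R : realType).
Variable mu : {sigma_finite_measure set T -> \bar R}.
Local Notation leb := (@lebesgue_measure R).

(** Tonelli on the region [A] under the graph of [h]: slices over a point have length [h x], slices
    at a height [s >= 0] are superlevel sets. *)
Lemma layer_cake (h : T -> R) : measurable_fun setT h -> (forall x, 0 <= h x) ->
  (\int[mu]_x (h x)%:E =
   \int[leb]_(s in `[0%R, +oo[%classic) mu [set x | (s < h x)%R])%E.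
Proof.
move=> mh h0.
pose A := [set p : T * measurableTypeR R | 0 <= p.2 < h p.1].
have mA : measurable A.
  rewrite (_ : A = [set p | 0 <= p.2] `&` [set p | p.2 < h p.1]); last first.
    by apply/seteqP; split=> p /= /andP.
  have mf : measurable_fun setT (fun p : T * measurableTypeR R => 0 <= p.2)%R.
    exact: measurable_fun_ler.
  have mg : measurable_fun setT
      (fun p : T * measurableTypeR R => p.2 < h p.1)%R.
    by apply: measurable_fun_ltr => //; exact: measurableT_comp.
  apply: measurableI.
    by have := mf measurableT [set true]; rewrite setTI; exact.
  by have := mg measurableT [set true]; rewrite setTI; exact.
have := indic_fubini_tonelli mu leb mA.
rewrite indic_fubini_tonelli_FE// indic_fubini_tonelli_GE//= => H.
transitivity (\int[mu]_x leb (xsection A x))%E.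
  apply: eq_integral => x _.
  rewrite (_ : xsection A x = `[0, h x[%classic); last first.
    by apply/seteqP; split=> s; rewrite /xsection/= inE/= in_itv.
  rewrite lebesgue_measure_itv/= lte_fin.
  case: ltP => hx; first by rewrite sube0.
  by congr (_%:E); apply/eqP; rewrite eq_le hx h0.
rewrite H [RHS]integral_mkcond; apply: eq_integral => s _; rewrite patchE.
case: ifPn; rewrite ?inE ?notin_setE/= in_itv/= andbT => s0.
  rewrite (_ : ysection A s = [set x | s < h x])//.
  by apply/seteqP; split=> x; rewrite /ysection/= inE/= /A/= s0.
rewrite (_ : ysection _ _ = set0) ?measure0//.
by rewrite -subset0 => x; rewrite /ysection/= inE/= /A/= => /andP[].
Qed.

End layer_cake.

(** * Euclidean inner product and sup norm *)

Section inner_product.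
Variables (R : realType) (n : nat).
Implicit Types x y z : 'rV[R]_n.

Lemma innerC x y : inner x y = inner y x.
Proof. by apply: eq_bigr => i _; rewrite mulrC. Qed.

Lemma innerDl x y z : inner (x + y) z = inner x z + inner y z.
Proof. by rewrite -big_split/=; apply: eq_bigr => i _; rewrite mxE mulrDl. Qed.

Lemma innerZl a x y : inner (a *: x) y = a * inner x y.
Proof. by rewrite mulr_sumr; apply: eq_bigr => i _; rewrite mxE mulrA. Qed.

Lemma innerDr x y z : inner x (y + z) = inner x y + inner x z.
Proof. by rewrite innerC innerDl !(innerC _ x). Qed.

Lemma innerZr a x y : inner x (a *: y) = a * inner x y.
Proof. by rewrite innerC innerZl (innerC _ x). Qed.

Lemma innerNl x y : inner (- x) y = - inner x y.
Proof. by rewrite -scaleN1r innerZl mulN1r. Qed.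

Lemma innerNr x y : inner x (- y) = - inner x y.
Proof. by rewrite innerC innerNl innerC. Qed.

Lemma inner_sqDZ x y a : inner (x + a *: y) (x + a *: y) =
  inner x x + a * (2 * inner x y + a * inner y y).
Proof. by rewrite innerDl !innerDr !innerZl !innerZr (innerC y x); ring. Qed.

Lemma inner_ge0 x : 0 <= inner x x.
Proof. by apply: sumr_ge0 => i _; rewrite -expr2 sqr_ge0. Qed.

Lemma inner_gt0 x : x != 0 -> 0 < inner x x.
Proof.
move=> x0; rewrite lt_neqAle inner_ge0 andbT; apply: contra x0 => /eqP/esym.
move=> /psumr_eq0P H; apply/eqP/rowP => i; rewrite mxE.
have /eqP := H (fun i _ => sqr_ge0 (x ord0 i)) i isT.
by rewrite mulf_eq0 orbb => /eqP.
Qed.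

Lemma continuous_innerr x : continuous (inner x).
Proof.
apply: continuous_big => [|i _ y]; first exact: add_continuous.
by apply: continuousM; [exact: cst_continuous|exact: coord_continuous].
Qed.

Lemma continuous_inner_diag : continuous (fun x => inner x x).
Proof.
apply: continuous_big => [|i _ y]; first exact: add_continuous.
by apply: continuousM; exact: coord_continuous.
Qed.

Lemma rV_coord_le_norm x j : `|x ord0 j| <= `|x|.
Proof.
rewrite [leRHS]/Num.norm/= mx_normrE.
by apply/bigmax_geP; right => /=; exists (ord0, j).
Qed.

Lemma rV_norm_le x (c : R) : 0 <= c -> (forall j, `|x ord0 j| <= c) ->
  `|x| <= c.
Proof.
move=> c0 xc; rewrite [leLHS]/Num.norm/= mx_normrE.
by apply/bigmax_leP; split=> // -[i j] _; rewrite (ord1 i).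
Qed.

End inner_product.

(** * The open orthant and its closure *)

Section orthant.
Variables (R : realType) (n : nat).
Implicit Types x y z : 'rV[R]_n.
Local Notation O := (@orthant R n).

Lemma orthantZ (s : R) x : 0 < s -> O x -> O (s *: x).
Proof. by move=> s0 Ox j; rewrite mxE mulr_gt0. Qed.

Lemma orthant_const (s : R) : 0 < s -> O (const_mx s).
Proof. by move=> s0 j; rewrite mxE. Qed.

Lemma open_orthant : open O.
Proof.
rewrite openE => x Ox; apply: (@filter_forall _ 'I_n
  (fun j => [set y : 'rV[R]_n | 0 < y ord0 j]) (nbhs x)) => j.
have cj : (fun y : 'rV[R]_n => y ord0 j) @ x --> x ord0 j.
  exact: coord_continuous.
exact: (cj _ (lt_nbhsr (Ox j))).
Qed.

(** Some point of the orthant is closer to [x] than [y ord0 j], whence [x ord0 j > - y ord0 j]. *)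
Lemma closure_orthantD x y : closure O x -> O y -> O (x + y).
Proof.
move=> Ox Oy j; rewrite mxE.
have [z [Oz]] := Ox _ (nbhsx_ballx x (y ord0 j) (Oy j)).
move=> [_ /(_ ord0 j)]; rewrite /ball/= ltr_norml => /andP[].
have := Oz j; lra.
Qed.

End orthant.

(** * Euclidean projection onto a closed convex set *)

Section separation.
Variables (R : realType) (n : nat).
Implicit Types x y z : 'rV[R]_n.

(** The squared distance [q] attains its minimum on the compact part [K] of [P] lying no farther
    from [x] than [p0]; points outside [K] are farther still. *)
Lemma nearest_point (P : set 'rV[R]_n) x : closed P -> P !=set0 ->
  exists2 p, P p &
    forall y, P y -> inner (p - x) (p - x) <= inner (y - x) (y - x).
Proof.
move=> cP [p0 Pp0]; pose q y := inner (y - x) (y - x).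
have cq : continuous q.
  move=> y.
  apply: (@continuous_comp _ _ _ (fun y => y - x) (fun z => inner z z)).
    by apply: continuousB; [exact: cvg_id|exact: cst_continuous].
  exact: continuous_inner_diag.
pose K := P `&` [set y | q y <= q p0].
have cK : compact K.
  apply: bounded_closed_compact.
    (* The norm is the sup norm while [q] is a Euclidean square; the two are compared through
       [c <= 1 + c ^ 2] in each coordinate. *)
    exists (`|x| + (1 + q p0)); split; first exact: num_real.
    move=> M lM y [_ qy] /=; apply: le_trans (ltW lM).
    rewrite -[y](subrK x) addrC (le_trans (ler_normD _ _))// lerD2l.
    have q0 : 0 <= q p0 by exact: inner_ge0.
    apply: rV_norm_le => [|j]; first lra.
    apply: le_trans (_ : 1 + q y <= _); last by rewrite lerD2l.
    have : `|(y - x) ord0 j| ^+ 2 <= q y.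
      rewrite real_normK ?num_real// /q /inner (bigD1 j)//= expr2 lerDl.
      by apply: sumr_ge0 => i _; rewrite -expr2 sqr_ge0.
    have := sqr_ge0 (`|(y - x) ord0 j| - 1); nra.
  apply: closedI => //.
  apply: (@preimage_closed _ _ q [set r | r <= q p0]) => //; exact: closed_le.
have [p Kp minp] := EVT_min_rV (ex_intro _ p0 (conj Pp0 (lexx _))) cK
  (continuous_subspaceT cq).
move: Kp; rewrite inE => -[Pp qp]; exists p => // y Py.
have [qy|/ltW qy] := leP (q y) (q p0); first by apply: minp; rewrite inE.
exact: le_trans qp qy.
Qed.

Lemma convex_setP (P : set 'rV[R]_n) x y (l : R) : convex_set P ->
  P x -> P y -> 0 <= l <= 1 -> P (l *: x + (1 - l) *: y).
Proof.
move=> cP Px Py /andP[l0 l1].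
have := cP x y (Itv01 l0 l1); rewrite !inE; exact.
Qed.

(** First-order condition at the minimum: moving from [p] a fraction [l] towards [y] does not
    decrease the squared distance. *)
Lemma nearest_point_obtuse (P : set 'rV[R]_n) x p : convex_set P -> P p ->
  (forall y, P y -> inner (p - x) (p - x) <= inner (y - x) (y - x)) ->
  forall y, P y -> 0 <= inner (p - x) (y - p).
Proof.
move=> cP Pp minp y Py; rewrite leNgt; apply/negP => neg.
pose a := inner (p - x) (y - p); pose b := inner (y - p) (y - p).
have step (l : R) : 0 < l -> l <= 1 -> 0 <= 2 * a + l * b.
  move=> l0 l1; have := minp _ (convex_setP cP Py Pp _).
  move=> /(_ l); rewrite (ltW l0) l1 => /(_ isT).
  rewrite (_ : _ + _ - x = (p - x) + l *: (y - p)); last first.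
    by apply/rowP => i; rewrite !mxE; ring.
  rewrite inner_sqDZ -/a -/b => H.
  by rewrite -(pmulr_rge0 _ l0); lra.
have b0 : 0 <= b by exact: inner_ge0.
(* For this [l] one has [l * b <= - a], so [2 * a + l * b <= a < 0]; the [+ 1] keeps the denominator
   positive. *)
have := step (Num.min 1 (- a / (b + 1))).
rewrite lt_min ltr01 divr_gt0 ?oppr_gt0// ?ltr_wpDl//.
rewrite ge_min lexx => /(_ isT isT).
have : Num.min 1 (- a / (b + 1)) <= - a / (b + 1) by rewrite ge_min lexx orbT.
have : (- a / (b + 1)) * b <= - a.
  rewrite -mulrA ger_pMr ?oppr_gt0// mulrC ler_pdivrMr; lra.
rewrite -/a in neg; nra.
Qed.

End separation.

(** * The gauge of a complete convex set, through its copolar *)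

Section gauge.
Variables (R : realType) (n : nat).
Implicit Types (x y z u v : 'rV[R]_n) (P : set 'rV[R]_n).
Local Notation O := (@orthant R n).

(** Minus the support function of [copolar P]; support functions are additive under Minkowski sums,
    so copolar combinations become linear. *)
Definition gauge P x : R := inf [set - inner u x | u in copolar P].

(** Completeness keeps the ray [y + l *: x] inside [P], where [inner u] stays at most [-1], so it
    cannot increase along the ray. *)
Lemma complete_copolar_le0 P u x : complete_set P -> P !=set0 ->
  copolar P u -> O x -> inner u x <= 0.
Proof.
move=> cP [y Py] Pu Ox; rewrite leNgt; apply/negP => ux.
pose l := (`|inner u y| + 1) / inner u x.
have l0 : 0 < l by rewrite divr_gt0// ltr_wpDl.
have /Pu : P (y + l *: x).
  by apply: cP; exists y => //; exists (l *: x) => //; exact: orthantZ.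
rewrite innerDr innerZr /l divfK ?gt_eqF//.
have := ler_norm (- inner u y); rewrite normrN; lra.
Qed.

Lemma cobounded_nonempty P : (0 < n)%N -> cobounded P -> P !=set0.
Proof.
move=> n0 [M [_ bM]]; apply/set0P/eqP => P0.
have M1 : M < `|M| + 1 by rewrite (le_lt_trans (ler_norm _))// ltrDl.
pose c := `|M| + 2.
have Oc : (O `\` P) (const_mx c).
  by rewrite P0 setD0; apply: orthant_const; rewrite /c ltr_wpDl.
have := bM _ M1 _ Oc; have := rV_coord_le_norm (const_mx c) (Ordinal n0).
rewrite mxE /= => /le_trans/[apply].
by rewrite ger0_norm ?addr_ge0// /c; lra.
Qed.

(** With [w] pointing from [x] to its nearest point [p], the hyperplane through [p] normal to [w]
    separates; dividing by [inner w p] and changing sign puts the functional in the copolar. *)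
Lemma separation P x : closed P -> convex_set P -> complete_set P -> P !=set0 ->
  O x -> ~ P x -> exists2 u, copolar P u & - inner u x < 1.
Proof.
move=> clP cvP cP P0 Ox nPx.
have [p Pp minp] := nearest_point x clP P0.
have obt := nearest_point_obtuse cvP Pp minp; set w := p - x in obt *.
(* Completeness allows [p + z] as a test point in the obtuse-angle inequality. *)
have w_ge0 z : O z -> 0 <= inner w z.
  move=> Oz; have /obt : P (p + z) by apply: cP; exists p => //; exists z.
  by rewrite addrAC subrr add0r.
have ww : 0 < inner w w.
  apply: inner_gt0; rewrite /w subr_eq0; apply/eqP => px.
  by apply: nPx; rewrite -px.
have wp : inner w p = inner w x + inner w w.
  by rewrite -innerDr; congr inner; rewrite /w addrC subrK.
have wp0 : 0 < inner w p by rewrite wp ltr_wpDl// w_ge0.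
exists (- ((inner w p)^-1 *: w)).
  move=> y Py; rewrite innerNl innerZl lerN2 mulrC ler_pdivlMr// mul1r.
  by have := obt y Py; rewrite innerDr innerNr subr_ge0.
by rewrite innerNl opprK innerZl mulrC ltr_pdivrMr// mul1r wp ltrDl.
Qed.

(** * Homogeneity, monotonicity and semicontinuity of the gauge *)

Section gauge_theory.
Variable P : set 'rV[R]_n.
Hypothesis n_gt0 : (0 < n)%N.
Hypothesis P_CC : (@CC_plus R n `\ closure O) P.

Let P0 : P !=set0.
Proof. by apply: cobounded_nonempty => //; have [[]] := P_CC. Qed.

Let P_complete : complete_set P.
Proof. by have [[[]]] := P_CC. Qed.

Let P_sep x : O x -> ~ P x -> exists2 u, copolar P u & - inner u x < 1.
Proof. by have [[[_ clP cvP cP] _] _] := P_CC; exact: separation. Qed.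

(** A closed [P] containing the orthant would be its closure, which is excluded; separating a missed
    point yields an element. *)
Lemma copolar_nonempty : copolar P !=set0.
Proof.
have [x Ox nPx] : exists2 x, O x & ~ P x.
  apply: contrapT => H; have [[[PO clP _ _] _] []] := P_CC.
  apply/seteqP; split=> //; rewrite closureE; apply: smallest_sub => //.
  by move=> x Ox; apply: contrapT => nPx; apply: H; exists x.
by have [u Pu _] := P_sep Ox nPx; exists u.
Qed.

Lemma gauge_lbound x : O x -> lbound [set - inner u x | u in copolar P] 0.
Proof.
by move=> Ox _ [u Pu <-]; rewrite oppr_ge0; exact: complete_copolar_le0 Pu Ox.
Qed.

Let gauge_set_nonempty x : [set - inner u x | u in copolar P] !=set0.
Proof. by have [u Pu] := copolar_nonempty; exists (- inner u x), u. Qed.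

Lemma gauge_ge0 x : O x -> 0 <= gauge P x.
Proof. by move=> Ox; apply: lb_le_inf => //; exact: gauge_lbound. Qed.

Lemma gauge_le x u : O x -> copolar P u -> gauge P x <= - inner u x.
Proof.
by move=> Ox Pu; apply: ge_inf; [exists 0; exact: gauge_lbound|exists u].
Qed.

Lemma gauge_ltP x a : O x ->
  gauge P x < a <-> exists2 u, copolar P u & - inner u x < a.
Proof.
move=> Ox; split=> [/inf_lt[]// _ [u Pu <-] ua|[u Pu]]; first by exists u.
exact: le_lt_trans (gauge_le Ox Pu).
Qed.

Lemma gauge_ge x a : (forall u, copolar P u -> a <= - inner u x) ->
  a <= gauge P x.
Proof. by move=> H; apply: lb_le_inf => // _ [u Pu <-]; exact: H. Qed.

Lemma gaugeZ s x : 0 < s -> O x -> gauge P (s *: x) = s * gauge P x.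
Proof.
move=> s0 Ox; apply/eqP; rewrite eq_le; apply/andP; split.
  rewrite mulrC -ler_pdivrMr//; apply: gauge_ge => u Pu.
  rewrite ler_pdivrMr// mulrC mulrN -innerZr.
  by apply: gauge_le => //; exact: orthantZ.
apply: gauge_ge => u Pu; rewrite innerZr -mulrN ler_pM2l//.
exact: gauge_le.
Qed.

Lemma gauge_le_mono x y : O x -> O y -> O (y - x) -> gauge P x <= gauge P y.
Proof.
move=> Ox Oy Oyx; apply: gauge_ge => u Pu.
rewrite (le_trans (gauge_le Ox Pu))// lerN2 -[y](subrK x) innerDr gerDr.
exact: complete_copolar_le0 Pu Oyx.
Qed.

Lemma gauge_lt1P x : O x -> gauge P x < 1 <-> ~ P x.
Proof.
move=> Ox; rewrite gauge_ltP//; split=> [[u Pu]|]; last exact: P_sep.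
by move=> ux Px; have := Pu x Px; rewrite leNgt ltrNl ux.
Qed.

(** Upper semicontinuity: an infimum of linear forms is below [a] on a union of open half-spaces. *)
Lemma open_gauge_lt a : open [set x | O x /\ gauge P x < a].
Proof.
rewrite (_ : [set x | _] = O `&`
    \bigcup_(u in copolar P) [set x | - inner u x < a]); last first.
  apply/seteqP; split=> [x [Ox] /(gauge_ltP _ Ox)[u Pu ux]|x [Ox [u Pu ux]]].
    by split => //; exists u.
  by split => //; apply/gauge_ltP => //; exists u.
apply: openI; first exact: open_orthant.
apply: bigcup_open => u _.
rewrite (_ : [set x | _] = inner u @^-1` [set r | - a < r]); last first.
  by apply/seteqP; split=> x /=; rewrite ltrNl.
apply: open_comp; last exact: open_gt.
by move=> x _; exact: continuous_innerr.
Qed.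

(** Lower semicontinuity, which an infimum does not give for free: points near [x] dominate [s *: x]
    for some [s < 1], so monotonicity and homogeneity apply. *)
Lemma near_gauge_gt x a : O x -> 0 <= a -> a < gauge P x ->
  \forall y \near x, O y /\ a < gauge P y.
Proof.
move=> Ox a0 ax.
(* The midpoint of [a / gauge P x] and [1], so that [s < 1] and [s * gauge P x] still exceeds
   [a]. *)
pose s := (1 + a / gauge P x) / 2.
have g0 : 0 < gauge P x by exact: le_lt_trans ax.
have s1 : 0 < s < 1.
  have : a / gauge P x < 1 by rewrite ltr_pdivrMr// mul1r.
  have : 0 <= a / gauge P x by rewrite divr_ge0// ltW.
  by rewrite /s; lra.
have as' : a < s * gauge P x.
  have : a / gauge P x < s.
    have : a / gauge P x < 1 by rewrite ltr_pdivrMr// mul1r.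
    by rewrite /s; lra.
  by rewrite ltr_pdivrMr.
have /andP[s0 _] := s1.
have op : open [set y | O y /\ O (y - s *: x)].
  apply: openI; first exact: open_orthant.
  apply: (@open_comp _ _ (fun y => y - s *: x)); last exact: open_orthant.
  move=> y _; apply: (@continuousB _ _ _ id (cst (s *: x))).
    exact: cvg_id.
  exact: cst_continuous.
have : [set y | O y /\ O (y - s *: x)] x.
  split => // j; rewrite !mxE -{1}[x _ _]mul1r -mulrBl mulr_gt0 ?Ox//; lra.
move: op; rewrite openE => /[apply]; apply: filterS => y [Oy Oyx]; split=> //.
rewrite (lt_le_trans as')// -gaugeZ//; apply: gauge_le_mono => //.
exact: orthantZ.
Qed.

End gauge_theory.

Lemma copolar_combP P0 P1 (t : R) x : (0 < n)%N ->
  (@CC_plus R n `\ closure O) P0 -> (@CC_plus R n `\ closure O) P1 ->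
  0 < t < 1 -> O x ->
  copolar_comb P0 P1 t x <-> 1 <= (1 - t) * gauge P0 x + t * gauge P1 x.
Proof.
move=> n0 H0 H1 /andP[t0 t1] Ox; split.
  move=> cx; rewrite leNgt; apply/negP => lt1.
  (* The missing amount is granted to both gauges: the weights add up to one, so the combination
     stays below [1]. *)
  pose e := 1 - ((1 - t) * gauge P0 x + t * gauge P1 x).
  have [u Pu ux] : exists2 u, copolar P0 u & - inner u x < gauge P0 x + e.
    by apply/gauge_ltP => //; rewrite ltrDl subr_gt0.
  have [v Pv vx] : exists2 v, copolar P1 v & - inner v x < gauge P1 x + e.
    by apply/gauge_ltP => //; rewrite ltrDl subr_gt0.
  have : inner x ((1 - t) *: u + t *: v) <= -1.
    apply: cx; exists ((1 - t) *: u); first by exists u.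
    by exists (t *: v) => //; exists v.
  rewrite innerDr !innerZr !(innerC x) /e in ux vx *; nra.
move=> ge1 _ [_ [u Pu <-] [_ [v Pv <-] <-]].
rewrite innerDr !innerZr !(innerC x).
have := gauge_le n0 H0 Ox Pu; have := gauge_le n0 H1 Ox Pv; nra.
Qed.

(** Gauges decide membership only in the open orthant. A point of [P0] is therefore pushed inside by
    a small constant vector, staying in [P0] by completeness, and closedness of [P1] takes the
    limit. *)
Lemma gauge_inj P0 P1 : (0 < n)%N ->
  (@CC_plus R n `\ closure O) P0 -> (@CC_plus R n `\ closure O) P1 ->
  (forall x, O x -> gauge P0 x = gauge P1 x) -> P0 `<=` P1.
Proof.
move=> n0 H0 H1 eqg x P0x.
have [[[P0O _ _ c0] _] _] := H0; have [[[_ cl1 _ _] _] _] := H1.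
apply: cl1 => B /nbhs_ballP[e /= e0 eB].
have e20 : 0 < e / 2 by rewrite divr_gt0.
have Oe := @orthant_const R n _ e20.
have Oxe : O (x + const_mx (e / 2)).
  by apply: closure_orthantD => //; exact: P0O.
exists (x + const_mx (e / 2)); split.
  apply: contrapT => /(gauge_lt1P n0 H1 Oxe); rewrite -eqg//.
  move=> /(gauge_lt1P n0 H0 Oxe); apply.
  by apply: c0; exists x => //; exists (const_mx (e / 2)).
apply: eB; split => // i j; rewrite (ord1 i) /ball/= !mxE opprD addNKr normrN.
by rewrite gtr0_norm//; lra.
Qed.

End gauge.

(** * Volumes of sublevel sets as integrals of tents *)

Section sublevel_volume.
Variables (R : realType) (n : nat).
Implicit Types (x y z : 'rV[R]_n) (g : 'rV[R]_n -> R).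
Local Notation O := (@orthant R n).
Local Notation T := (measurableTypeR R).
Local Notation leb := (@lebesgue_measure R).
Local Notation L := (@lebesgue_tuple R n).

Definition sublevel g (a : R) := [set x | O x /\ g x < a].

(** What the volume computation uses of a gauge, in a form that passes to convex combinations of
    gauges; the last clause is upper semicontinuity. *)
Definition gauge_like g :=
  [/\ forall x, O x -> 0 <= g x,
      forall s x, 0 < s -> O x -> g (s *: x) = s * g x
    & forall a, open (sublevel g a)].

(** Extended by zero off the orthant, so that integrals run over the whole space. *)
Definition tent g x : R := if `[< O x >] then Num.max 0 (1 - g x) else 0.

Lemma tent_ge0 g x : 0 <= tent g x.
Proof. by rewrite /tent; case: ifP => // _; rewrite le_max lexx. Qed.

Lemma tent_superlevel g s : 0 <= s ->
  [set x | s < tent g x] = sublevel g (1 - s).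
Proof.
move=> s0; apply/seteqP; split=> x; rewrite /tent /sublevel/=.
  case: asboolP => Ox; last by rewrite ltNge s0.
  by rewrite lt_max ltNge s0/= => sx; split=> //; lra.
move=> [Ox gx]; rewrite asboolT// lt_max; apply/orP; right; lra.
Qed.

Lemma measurable_tent g : (forall a, open (sublevel g a)) ->
  measurable_fun setT (fun t : n.-tuple T => tent g (rV_of_tuple t)).
Proof.
move=> og; apply: (measurability _ (RGenOInfty.measurableE R)).
move=> _ [_ [a ->] <-]; rewrite setTI.
have [a0|a0] := leP 0 a.
  rewrite (_ : _ @^-1` _ = (@rV_of_tuple R n) @^-1` sublevel g (1 - a)).
    exact: measurable_open_rV.
  rewrite -(tent_superlevel _ a0).
  by apply/seteqP; split=> t /=; rewrite in_itv/= andbT.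
rewrite (_ : _ @^-1` _ = setT)//; apply/seteqP; split=> t //= _.
by rewrite in_itv/= andbT (lt_le_trans a0)// tent_ge0.
Qed.

(** Homogeneity makes [sublevel g r] the dilate of [sublevel g 1] by [r]. *)
Lemma Vol_sublevel g r : gauge_like g -> 0 < r ->
  Vol (sublevel g r) = ((r ^+ n)%:E * Vol (sublevel g 1))%E.
Proof.
move=> [_ gZ og] r0.
have mS := measurable_open_rV (og r).
have : Vol (sublevel g 1) = ((r ^- n)%:E * Vol (sublevel g r))%E.
  rewrite -(lebesgue_tuple_scale r0 mS); congr (lebesgue_tuple _).
  have rE (t : n.-tuple T) :
      rV_of_tuple (map_tuple ( *%R r) t) = r *: rV_of_tuple t.
    by apply/rowP => i; rewrite !mxE tnth_map.
  apply/seteqP; split=> t /=; rewrite /sublevel/= rE => -[Ox gx].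
    by split; [exact: orthantZ|rewrite gZ// -[ltRHS]mulr1 ltr_pM2l].
  have Ox' : O (rV_of_tuple t).
    rewrite -[rV_of_tuple t](scalerK (lt0r_neq0 r0)).
    by apply: orthantZ; rewrite ?invr_gt0.
  by split => //; move: gx; rewrite gZ// -[ltRHS]mulr1 ltr_pM2l.
move=> ->; rewrite muleA -EFinM mulfV ?mul1e//.
by rewrite expf_neq0// gt_eqF.
Qed.

(** For positive [n] its value is [1 / (n + 1)]; only positivity and finiteness enter below. *)
Definition tent_const : \bar R :=
  (\int[leb]_(s in `[0%R, +oo[%classic) ((Num.max 0 (1 - s)) ^+ n)%:E)%E.

Let measurable_tent_pow : measurable_fun (`[0%R, +oo[%classic : set T)
  (fun s : T => ((Num.max 0 (1 - s)) ^+ n)%:E).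
Proof.
apply/measurable_EFinP; apply: measurable_funX; apply: measurable_maxr => //.
exact: measurable_funB.
Qed.

Lemma integral_tent g : (0 < n)%N -> gauge_like g ->
  (\int[L]_t (tent g (rV_of_tuple t))%:E = tent_const * Vol (sublevel g 1))%E.
Proof.
move=> n0 gg; have [_ _ og] := gg.
rewrite layer_cake; [|exact: measurable_tent|by move=> t; exact: tent_ge0].
rewrite -ge0_integralZr//; last first.
  by move=> s _; rewrite lee_fin exprn_ge0// le_max lexx.
apply: eq_integral => s; rewrite inE/= in_itv/= andbT => s0.
transitivity (Vol (sublevel g (1 - s))).
  by rewrite -(tent_superlevel _ s0).
have [s1|s1] := ltP s 1.
  by rewrite max_r ?subr_ge0 1?ltW// Vol_sublevel// subr_gt0.
(* Beyond height [1] the sublevel set is empty, matching [0 ^+ n = 0] for positive [n]. *)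
rewrite max_l ?subr_le0// expr0n gtn_eqF//= mul0e.
rewrite (_ : sublevel g _ = set0) ?measure0//.
rewrite -subset0 => x [Ox]; rewrite ltNge; have [g0 _ _] := gg.
by rewrite (le_trans _ (g0 _ Ox))// subr_le0.
Qed.

(** On [[0, 1/2]] the integrand is at least [2^-1 ^+ n]. *)
Lemma tent_const_gt0 : (0 < tent_const)%E.
Proof.
pose h : R := 2^-1; have half0 : 0 < h by rewrite invr_gt0.
have pos : (0 < \int[leb]_(s in `[0%R, h]%classic) (h ^+ n)%:E)%E.
  rewrite integral_cst//= lebesgue_measure_itv/= lte_fin half0.
  by rewrite sube0 -EFinM lte_fin mulr_gt0// exprn_gt0.
apply: (lt_le_trans pos).
have sub : `[0, h] `<=` `[(0 : R), +oo[%classic by apply: subset_itvl.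
have le1 : (\int[leb]_(s in `[0%R, h]%classic) (h ^+ n)%:E <=
    \int[leb]_(s in `[0%R, h]%classic) ((Num.max 0 (1 - s)) ^+ n)%:E)%E.
  apply: ge0_le_integral => //=.
  - by move=> s _; rewrite lee_fin exprn_ge0// ltW.
  - exact: (measurable_funS _ sub measurable_tent_pow).
  - move=> s; rewrite in_itv/= => /andP[s0 s1]; rewrite lee_fin.
    apply: lerXn2r; rewrite ?nnegrE ?le_max ?lexx//; first exact: ltW.
    by apply/orP; right; rewrite /h in s1 *; lra.
apply: (le_trans le1).
apply: ge0_subset_integral => //=.
by move=> s _; rewrite lee_fin exprn_ge0// le_max lexx.
Qed.

(** The integrand is dominated by the indicator of [[0, 1]]. *)
Lemma tent_const_lty : (0 < n)%N -> (tent_const < +oo)%E.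
Proof.
move=> n0.
have le1 : (tent_const <=
    \int[leb]_(s in `[0%R, +oo[%classic) (\1_`[0%R, 1%R] s)%:E)%E.
  apply: ge0_le_integral => //=.
  - by move=> s _; rewrite lee_fin exprn_ge0// le_max lexx.
  - by apply/measurable_EFinP.
  - move=> s; rewrite in_itv/= andbT => s0; rewrite lee_fin indicE.
    case: (leP s 1) => s1.
      rewrite mem_set/= ?in_itv/= ?s0//.
      by rewrite exprn_ile1// ?le_max ?lexx// ge_max ler01/=; lra.
    rewrite memNset/= ?in_itv/=; last by rewrite s0/= leNgt s1.
    by rewrite max_l ?expr0n ?gtn_eqF//; lra.
apply: (le_lt_trans le1); rewrite integral_indic//= setIidl; last first.
  by apply: subset_itvl.
by rewrite lebesgue_measure_itv/= lte_fin ltr01 sube0 ltry.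
Qed.

End sublevel_volume.

(** * Convex combinations of gauges: inequality and strictness *)

Section mix.
Variables (R : realType) (n : nat).
Implicit Types (x y z : 'rV[R]_n) (g : 'rV[R]_n -> R).
Local Notation O := (@orthant R n).
Local Notation T := (measurableTypeR R).
Local Notation L := (@lebesgue_tuple R n).

Definition mix (t : R) g0 g1 x := (1 - t) * g0 x + t * g1 x.

Lemma mix_gauge_like t g0 g1 : 0 < t < 1 -> gauge_like g0 -> gauge_like g1 ->
  gauge_like (mix t g0 g1).
Proof.
move=> /andP[t0 t1] [p0 h0 o0] [p1 h1 o1]; split.
- move=> x Ox; have := p0 x Ox; have := p1 x Ox; rewrite /mix; nra.
- by move=> s x s0 Ox; rewrite /mix h0// h1//; ring.
move=> a; rewrite openE => x [Ox ax].
(* If neither function rises by as much as [e], neither does their convex combination. *)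
pose e := a - mix t g0 g1 x.
have e0 : 0 < e by rewrite subr_gt0.
have near0 : nbhs x (sublevel g0 (g0 x + e)).
  by have := o0 (g0 x + e); rewrite openE; apply; split=> //; rewrite ltrDl.
have near1 : nbhs x (sublevel g1 (g1 x + e)).
  by have := o1 (g1 x + e); rewrite openE; apply; split=> //; rewrite ltrDl.
apply: filterS2 near0 near1 => y [Oy y0] [_ y1]; split=> //.
by rewrite /mix /e /mix in y0 y1 *; nra.
Qed.

Lemma tent_mix_le t g0 g1 x : 0 < t < 1 ->
  tent (mix t g0 g1) x <= (1 - t) * tent g0 x + t * tent g1 x.
Proof.
move=> /andP[t0 t1]; rewrite /tent; case: asboolP => Ox; last by nra.
have max0 (y : R) : 0 <= Num.max 0 y by rewrite le_max lexx.
have maxr (y : R) : y <= Num.max 0 y by rewrite le_max lexx orbT.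
have t1' : 0 <= 1 - t by rewrite subr_ge0 ltW.
rewrite ge_max; apply/andP; split.
  by rewrite addr_ge0// mulr_ge0// ltW.
rewrite (_ : 1 - mix t g0 g1 x = (1 - t) * (1 - g0 x) + t * (1 - g1 x)).
  by rewrite lerD// ler_wpM2l// ltW.
by rewrite /mix; ring.
Qed.

(* One tent is in its affine regime and the other one vanishes, so that the
   convexity is strict, with a gap that does not depend on [x]. *)
Lemma tent_mix_gap t g0 g1 a b x : 0 < t < 1 -> O x ->
  g0 x < a -> a < 1 -> 1 < b -> b < g1 x ->
  tent (mix t g0 g1) x + Num.min ((1 - t) * (1 - a)) (t * (b - 1)) <=
  (1 - t) * tent g0 x + t * tent g1 x.
Proof.
move=> /andP[t0 t1] Ox xa a1 b1 bx; rewrite /tent asboolT//.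
rewrite (max_r (_ : 0 <= 1 - g0 x)); last by lra.
rewrite (max_l (_ : 1 - g1 x <= 0)); last by lra.
have min0 : Num.min ((1 - t) * (1 - a)) (t * (b - 1)) <= (1 - t) * (1 - a).
  by rewrite ge_min lexx.
have min1 : Num.min ((1 - t) * (1 - a)) (t * (b - 1)) <= t * (b - 1).
  by rewrite ge_min lexx orbT.
rewrite -lerBrDr ge_max /mix; apply/andP; split; nra.
Qed.

Lemma integral_tent_comb t g0 g1 : (0 < n)%N -> 0 < t < 1 ->
  gauge_like g0 -> gauge_like g1 ->
  (\int[L]_u ((1 - t) * tent g0 (rV_of_tuple u) +
     t * tent g1 (rV_of_tuple u))%:E =
   tent_const R n * ((1 - t)%:E * Vol (sublevel g0 1) +
     t%:E * Vol (sublevel g1 1)))%E.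
Proof.
move=> n0 /andP[t0 t1] H0 H1.
have t0' : 0 <= t by exact: ltW.
have t1' : 0 <= 1 - t by rewrite subr_ge0 ltW.
have [[_ _ o0] [_ _ o1]] := (H0, H1).
have m0 := measurable_tent o0; have m1 := measurable_tent o1.
under eq_integral do rewrite EFinD !EFinM.
rewrite ge0_integralD//; last 4 first.
- by move=> u _; rewrite -EFinM lee_fin mulr_ge0// tent_ge0.
- by apply/measurable_EFinP/measurable_funM.
- by move=> u _; rewrite -EFinM lee_fin mulr_ge0// tent_ge0.
- by apply/measurable_EFinP/measurable_funM.
have scale k g : 0 <= k -> gauge_like g ->
    (\int[L]_u (k%:E * (tent g (rV_of_tuple u))%:E) =
     k%:E * (tent_const R n * Vol (sublevel g 1)))%E.
  move=> k0 gg; rewrite -integral_tent//; apply: ge0_integralZl => //.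
  - have [_ _ og] := gg; apply/measurable_EFinP; exact: measurable_tent.
  - by move=> u _; rewrite lee_fin tent_ge0.
rewrite !scale//.
rewrite ge0_muleDr ?mule_ge0 ?measure_ge0 ?lee_fin//.
by rewrite !(muleCA (tent_const R n)).
Qed.

Lemma Vol_mix_le t g0 g1 : (0 < n)%N -> 0 < t < 1 ->
  gauge_like g0 -> gauge_like g1 ->
  (Vol (sublevel (mix t g0 g1) 1) <=
     (1 - t)%:E * Vol (sublevel g0 1) + t%:E * Vol (sublevel g1 1))%E.
Proof.
move=> n0 t01 H0 H1; have Hm := mix_gauge_like t01 H0 H1.
have [[_ _ o0] [_ _ o1]] := (H0, H1); have [_ _ om] := Hm.
have m0 := measurable_tent o0; have m1 := measurable_tent o1.
(* Multiplying by the positive finite constant turns volumes into tent integrals, compared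
   pointwise. *)
rewrite -(@lee_pmul2l _ (tent_const R n)) ?tent_const_gt0//; last first.
  by rewrite ge0_fin_numE ?tent_const_lty// ltW// tent_const_gt0.
rewrite -integral_tent// -integral_tent_comb//.
apply: ge0_le_integral => //.
- by move=> u _; rewrite lee_fin tent_ge0.
- by apply/measurable_EFinP; exact: measurable_tent.
- by apply/measurable_EFinP/measurable_funD; apply/measurable_funM.
- by move=> u _; rewrite lee_fin tent_mix_le.
Qed.

(** Lower semicontinuity of [g1] spreads the strict inequality at [x] to a box; finite volumes keep
    the resulting gain from being absorbed by infinity. *)
Lemma Vol_mix_lt t g0 g1 x : (0 < n)%N -> 0 < t < 1 ->
  gauge_like g0 -> gauge_like g1 ->
  (forall y a, O y -> 0 <= a -> a < g1 y ->
    \forall z \near y, O z /\ a < g1 z) ->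
  O x -> g0 x < 1 -> 1 < g1 x ->
  (Vol (sublevel g0 1) < +oo)%E -> (Vol (sublevel g1 1) < +oo)%E ->
  (Vol (sublevel (mix t g0 g1) 1) <
     (1 - t)%:E * Vol (sublevel g0 1) + t%:E * Vol (sublevel g1 1))%E.
Proof.
move=> n0 t01 H0 H1 nearg1 Ox x0 x1 V0 V1; have Hm := mix_gauge_like t01 H0 H1.
have [[_ _ o0] [_ _ o1]] := (H0, H1); have [_ _ om] := Hm.
have m0 := measurable_tent o0; have m1 := measurable_tent o1.
have mm := measurable_tent om.
have c_gt0 := @tent_const_gt0 R n; have c_fin : tent_const R n \is a fin_num.
  by rewrite ge0_fin_numE ?tent_const_lty// ltW.
have [a x0a a1] : exists2 a, g0 x < a & a < 1.
  by exists ((g0 x + 1) / 2); lra.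
have [b b1 bx1] : exists2 b, 1 < b & b < g1 x.
  by exists ((g1 x + 1) / 2); lra.
have near0 : nbhs x (sublevel g0 a).
  by have := o0 a; rewrite openE; apply.
have near1 : nbhs x [set z | O z /\ b < g1 z].
  by apply: nearg1 => //; lra.
have : nbhs x (sublevel g0 a `&` [set z | O z /\ b < g1 z]) by exact: filterI.
move=> /nbhs_ballP[e /= e0 eB].
(* The sup-norm ball of radius [e] around [x], written as a box of computable positive volume. *)
pose B := [set u : n.-tuple T |
  forall i, x ord0 i - e < tnth u i < x ord0 i + e].
have mB : measurable B by exact: measurable_box.
have LB : (0 < L B)%E.
  rewrite lebesgue_tuple_box; last by move=> i; lra.
  by rewrite lte_fin prodr_gt0// => i _; lra.
pose eta := Num.min ((1 - t) * (1 - a)) (t * (b - 1)).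
have /andP[t0 t1] := t01.
have eta0 : 0 < eta by rewrite lt_min !mulr_gt0 ?subr_gt0.
have gap : (tent_const R n * Vol (sublevel (mix t g0 g1) 1) + eta%:E * L B <=
    tent_const R n * ((1 - t)%:E * Vol (sublevel g0 1) +
      t%:E * Vol (sublevel g1 1)))%E.
  rewrite -integral_tent// -integral_tent_comb//.
  have -> : (eta%:E * L B = \int[L]_u (eta%:E * (\1_B u)%:E))%E.
    rewrite ge0_integralZl ?integral_indic ?setIT ?lee_fin ?ltW//.
    exact/measurable_EFinP.
  rewrite -ge0_integralD//; last 4 first.
  - by move=> u _; rewrite lee_fin tent_ge0.
  - exact/measurable_EFinP.
  - by move=> u _; rewrite mule_ge0 ?lee_fin// ltW.
  - exact/measurable_funeM/measurable_EFinP.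
  apply: ge0_le_integral => //.
  - move=> u _; rewrite -EFinM -EFinD lee_fin.
    by rewrite addr_ge0 ?tent_ge0// mulr_ge0// ltW.
  - apply: emeasurable_funD; first exact/measurable_EFinP.
    exact/measurable_funeM/measurable_EFinP.
  - by apply/measurable_EFinP/measurable_funD; apply/measurable_funM.
  move=> u _; rewrite -EFinM -EFinD lee_fin indicE.
  have [|] := boolP (u \in B); rewrite ?inE => Bu; last first.
    by rewrite mulr0 addr0 tent_mix_le.
  rewrite mulr1; have [|[Ou u0] [_ u1]] := eB (rV_of_tuple u).
    split=> // i j; rewrite (ord1 i) /ball/= mxE ltr_distlC.
    by have /andP[] := Bu j; lra.
  exact: tent_mix_gap Ou u0 a1 b1 u1.
rewrite -(@lte_pmul2l _ (tent_const R n))//.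
apply: lt_le_trans gap; rewrite lteDl ?mule_gt0//.
(* Adding a positive term is strict only over a finite one; the weak inequality bounds the mixed
   volume. *)
rewrite fin_numM// ge0_fin_numE ?measure_ge0//.
apply: le_lt_trans (Vol_mix_le n0 t01 H0 H1) _.
by rewrite lte_add_pinfty// lte_mul_pinfty ?lee_fin ?subr_ge0 ?ltW.
Qed.

Lemma Vol_bounded (A : set 'rV[R]_n) : open A -> bounded_set A ->
  (Vol A < +oo)%E.
Proof.
move=> oA [M [_ bM]]; pose m := `|M| + 1.
have Mm : M < m by rewrite (le_lt_trans (ler_norm _))// ltrDl.
have m0 : 0 < m by rewrite ltr_wpDl.
(* Coordinates are at most [m] in absolute value; one more unit makes the bounds strict. *)
pose B := [set u : n.-tuple T | forall i, - (m + 1) < tnth u i < m + 1].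
apply: (@le_lt_trans _ _ (L B)).
  apply: le_measure; rewrite ?inE.
  - exact: measurable_open_rV.
  - exact: measurable_box.
  move=> u Au i; have := rV_coord_le_norm (rV_of_tuple u) i.
  rewrite mxE => /le_trans/(_ (bM _ Mm _ Au)).
  by rewrite ler_norml; lra.
by rewrite lebesgue_tuple_box ?ltry// => i; lra.
Qed.

End mix.

(** * Covolumes expressed through gauges *)

Section covolume.
Variables (R : realType) (n : nat).
Implicit Types (P : set 'rV[R]_n).
Hypothesis n_gt0 : (0 < n)%N.
Local Notation O := (@orthant R n).

Lemma gauge_is_gauge_like P :
  (@CC_plus R n `\ closure O) P -> gauge_like (gauge P).
Proof.
move=> HP; split; [exact: gauge_ge0|exact: gaugeZ|exact: open_gauge_lt].
Qed.

Lemma orthant_setD_gauge P : (@CC_plus R n `\ closure O) P ->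
  O `\` P = sublevel (gauge P) 1.
Proof.
by move=> HP; apply/seteqP; split=> x [Ox] /(gauge_lt1P n_gt0 HP Ox).
Qed.

Lemma orthant_setD_copolar_comb P0 P1 t :
  (@CC_plus R n `\ closure O) P0 -> (@CC_plus R n `\ closure O) P1 ->
  0 < t < 1 ->
  O `\` copolar_comb P0 P1 t = sublevel (mix t (gauge P0) (gauge P1)) 1.
Proof.
move=> H0 H1 t01; apply/seteqP; split=> x [Ox].
  by move=> /(copolar_combP n_gt0 H0 H1 t01 Ox)/negP; rewrite -ltNge.
move=> lt1; split=> // /(copolar_combP n_gt0 H0 H1 t01 Ox).
by apply/negP; rewrite -ltNge.
Qed.

Lemma Covol_lty P : (@CC_plus R n `\ closure O) P -> (Covol P < +oo)%E.
Proof.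
move=> HP; have [[_ bP] _] := HP; apply: Vol_bounded => //.
by rewrite orthant_setD_gauge//; exact: open_gauge_lt.
Qed.

Lemma Covol_copolar_comb_lt P0 P1 t x :
  (@CC_plus R n `\ closure O) P0 -> (@CC_plus R n `\ closure O) P1 ->
  0 < t < 1 -> O x -> gauge P0 x < gauge P1 x ->
  (Covol (copolar_comb P0 P1 t) < (1 - t)%:E * Covol P0 + t%:E * Covol P1)%E.
Proof.
move=> H0 H1 t01 Ox lt01.
have g0 := gauge_ge0 n_gt0 H0 Ox.
(* Rescaling by [c] makes the mean of the two gauge values equal to [1], which then lies strictly
   between them. *)
pose c := 2 / (gauge P0 x + gauge P1 x).
have s0 : 0 < gauge P0 x + gauge P1 x by lra.
have c0 : 0 < c by rewrite divr_gt0.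
rewrite /Covol orthant_setD_copolar_comb// !orthant_setD_gauge//.
apply: (@Vol_mix_lt _ _ _ _ _ (c *: x)) => //.
- exact: gauge_is_gauge_like.
- exact: gauge_is_gauge_like.
- by move=> y a Oy a0 ay; exact: near_gauge_gt.
- exact: orthantZ.
- by rewrite gaugeZ// /c mulrAC ltr_pdivrMr//; lra.
- by rewrite gaugeZ// /c mulrAC ltr_pdivlMr//; lra.
- by rewrite -orthant_setD_gauge//; exact: Covol_lty.
- by rewrite -orthant_setD_gauge//; exact: Covol_lty.
Qed.

(** Serves to swap the roles of the two sets when the gauges compare in the opposite order. *)
Lemma copolar_combC P0 P1 t : copolar_comb P0 P1 t = copolar_comb P1 P0 (1 - t).
Proof.
rewrite /copolar_comb subKr; congr copolar.
by apply/seteqP; split=> _ [u Hu [v Hv <-]]; exists v => //; exists u => //;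
  rewrite addrC.
Qed.

End covolume.

Theorem theorem4p1 (R : realType) (n : nat) (hn : (0 < n)%N)
    (P0 P1 : set 'rV[R]_n)
    (hP0 : (@CC_plus R n `\ closure (@orthant R n)) P0)
    (hP1 : (@CC_plus R n `\ closure (@orthant R n)) P1) :
  (forall t : R, 0 < t < 1 ->
     (Covol (copolar_comb P0 P1 t)
        <= (1 - t)%:E * Covol P0 + t%:E * Covol P1)%E) /\
  ((exists t : R, 0 < t < 1 /\
      Covol (copolar_comb P0 P1 t)
        = ((1 - t)%:E * Covol P0 + t%:E * Covol P1)%E) <-> P0 = P1).
Proof.
split=> [t t01|].
  rewrite /Covol orthant_setD_copolar_comb// !orthant_setD_gauge//.
  by apply: Vol_mix_le => //; exact: gauge_is_gauge_like.
split=> [[t [t01 eqt]]|eq01].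
  (* Any point where the gauges differ would make the inequality strict at this [t]. *)
  have eqg x : orthant x -> gauge P0 x = gauge P1 x.
    move=> Ox; have [lt01|lt10|//] := ltgtP (gauge P0 x) (gauge P1 x).
      by have := Covol_copolar_comb_lt hn hP0 hP1 t01 Ox lt01; rewrite eqt ltxx.
    have t01' : 0 < 1 - t < 1 by lra.
    have := Covol_copolar_comb_lt hn hP1 hP0 t01' Ox lt10.
    by rewrite -copolar_combC eqt subKr addeC ltxx.
  apply/seteqP; split; first exact: gauge_inj.
  by apply: gauge_inj => // x Ox; rewrite eqg.
have half01 : 0 < (2^-1 : R) < 1 by lra.
exists 2^-1; split=> //; rewrite -eq01.
(* Finiteness permits adding the two coefficients in the extended reals. *)
have finP0 : Covol P0 \is a fin_num.
  by rewrite ge0_fin_numE ?Covol_lty//; exact: measure_ge0.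
rewrite -muleDl// ?ge0_adde_def ?inE ?lee_fin//.
rewrite -EFinD subrK mul1e /Covol orthant_setD_copolar_comb//.
rewrite orthant_setD_gauge//; congr Vol; apply/seteqP.
(* A convex combination of a gauge with itself is that gauge. *)
by split=> x []; rewrite /mix /sublevel/= -mulrDl subrK mul1r.
Qed.
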